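(* In the $5x+1$ repeated random walk model, with probability one the quantities $t^-(n,\omega)=\inf\{e^{Z_{k,n}}:k\ge0\}$ are finite for every $n\ge1$. Moreover, with probability one, $$\liminf_{n\to\infty}\frac{\log t^-(n,\omega)}{\log n}=\liminf_{n\to\infty}\Big(\inf_{k\ge0}\frac{Z_{k,n}}{\log n}\Big)=1-\frac{1}{\theta^*},$$ where $\theta^*$ is the larger of the two real roots of $M_{5,RRW}(\theta)=1$, with $M_{5,RRW}(\theta)=\tfrac12\big(2^\theta+(\tfrac25)^\theta\big)$ (numerically $\theta^*\approx 0.3490813$ and $1-1/\theta^*\approx-1.86466$).
   Context: The $5x+1$ repeated random walk (RRW) model: for each integer $n\ge1$ take an independent sequence $(\delta_{i,n})_{i\ge1}$ of i.i.d. Bernoulli random variables with $\mathbb P[\delta=0]=\mathbb P[\delta=1]=\tfrac12$ (all sequences mutually independent), put $W_{i,n}=-\log 2+\delta_{i,n}\log 5$, and define $Z_{0,n}=\log n$, $Z_{k,n}=\log n+W_{1,n}+\cdots+W_{k,n}$. A realization is $\omega=\{Z_{k,n}\}$. The equation $M_{5,RRW}(\theta)=1$ has the root $\theta=0$ and one positive root. *)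

(* Defs.v *)
From mathcomp Require Import all_boot all_order all_algebra.
From mathcomp Require Import finmap.
From mathcomp Require Import all_classical all_reals all_analysis.

Set Implicit Arguments.
Unset Strict Implicit.
Unset Printing Implicit Defensive.

Import Order.TTheory GRing.Theory Num.Theory.
Import numFieldNormedType.Exports.

Local Open Scope classical_set_scope.
Local Open Scope ring_scope.

Definition fair_bernoulli (R : realType) (d : measure_display)
    (T : measurableType d) (P : probability T R) (X : {RV P >-> R}) : Prop :=
  P (X @^-1` [set 0]) = (2^-1)%:E /\ P (X @^-1` [set 1]) = (2^-1)%:E.

Definition mutually_independent (R : realType) (d : measure_display)
    (T : measurableType d) (P : probability T R) (I : choiceType)
    (D : set I) (X : I -> {RV P >-> R}) : Prop :=
  forall (J : {fset I}) (B : I -> set R),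
    [set` J] `<=` D ->
    (forall j, j \in J -> measurable (B j)) ->
    P (\bigcap_(j in [set` J]) X j @^-1` B j) =
      (\prod_(j <- J) P (X j @^-1` B j))%E.

(* [delta i n] is the i-th step of the walk started at log n; both indices run
   from 1, and nothing is assumed about delta when an index is 0. *)
Definition rrw_model (R : realType) (d : measure_display)
    (T : measurableType d) (P : probability T R)
    (delta : nat -> nat -> {RV P >-> R}) : Prop :=
  (forall i n, (0 < i)%N -> (0 < n)%N -> fair_bernoulli (delta i n)) /\
  mutually_independent [set p : nat * nat | (0 < p.1)%N /\ (0 < p.2)%N]
    (fun p => delta p.1 p.2).

Section Walk.
Variables (R : realType) (d : measure_display) (T : measurableType d).
Variables (P : probability T R) (delta : nat -> nat -> {RV P >-> R}).

Definition W5 (i n : nat) (w : T) : R := - ln 2 + delta i n w * ln 5.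

Definition Z5 (k n : nat) (w : T) : R :=
  ln n%:R + \sum_(1 <= i < k.+1) W5 i n w.

Definition t_minus (n : nat) (w : T) : \bar R :=
  ereal_inf [set (expR (Z5 k n w))%:E | k in [set: nat]].

End Walk.

Definition M5_RRW (R : realType) (theta : R) : R :=
  2^-1 * (2 `^ theta + (2 / 5) `^ theta).

(* Main.v *)
Require Import Defs.
From mathcomp Require Import all_boot all_order all_algebra.
From mathcomp Require Import finmap.
From mathcomp Require Import all_classical all_reals all_analysis.
From mathcomp Require Import ring lra.

Set Implicit Arguments.
Unset Strict Implicit.
Unset Printing Implicit Defensive.

Import Order.TTheory GRing.Theory Num.Theory.
Import numFieldNormedType.Exports.

Local Open Scope classical_set_scope.
Local Open Scope ring_scope.

(** Up to a null set the first k steps of a walk are described by the set s of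
    upward steps, a uniform subset of 'I_k, and the walk has then fallen by
    k ln 2 - |s| ln 5.

    Upper tail: by exponential Markov, a fall of at least x after k steps has
    probability at most e^(- t x) M(t)^k.  Strict convexity of M gives M(t) < 1
    for 0 < t < theta*, so summing over k bounds the probability of a fall of
    (1/theta* + eps) ln n at any time by a constant times n^(- a) with a > 1,
    and the first Borel-Cantelli lemma gives the lower bound on the liminf.

    Lower tail: let p = (2/5)^theta* / 2, the probability of an upward step
    under the measure tilted by theta*, and mu = ln 2 - p ln 5 = M'(theta* ) > 0.
    The mode b of the binomial law (k, p) has mass at least 1/(k+1) and is within
    1 of (k+1) p.  Undoing the tilt, the walk falls by about k mu within k steps
    with probability at least of order e^(- theta* k mu) / (k+1).  Among the
    starting points n of size about e^(k beta), with beta slightly larger than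
    theta* mu, independence makes one succeed with probability tending to 1. *)

(** * Rational bounds for the exponential *)

Section ExpBounds.
Context {R : realType}.
Implicit Types (x r : R) (n i : nat).

(* Horner form of the Taylor expansion, with r in place of the tail: unlike the
   sum over factorials, it can be evaluated on concrete decimals. *)
Fixpoint exp_horner x n i r : R :=
  if n is m.+1 then 1 + x / i%:R * exp_horner x m i.+1 r else r.

(** The offset [i] is general for the induction: removing one Horner layer raises it by one. *)
Lemma exp_hornerE x n i r :
  exp_horner x n i.+1 r =
  \sum_(j < n) x ^+ j * (i`!%:R / (i + j)`!%:R) +
  x ^+ n * (i`!%:R / (i + n)`!%:R) * r.
Proof.
elim: n i => [|n IHn] i /=.
  by rewrite big_ord0 add0r expr0 addn0 divff ?mul1r// pnatr_eq0 -lt0n fact_gt0.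
have fi : i.+1`!%:R = i.+1%:R * i`!%:R :> R by rewrite factS natrM.
have i0 : i.+1%:R != 0 :> R by rewrite pnatr_eq0.
have step j : x / i.+1%:R * (x ^+ j * (i.+1`!%:R / (i.+1 + j)`!%:R)) =
    x ^+ j.+1 * (i`!%:R / (i + j.+1)`!%:R) :> R.
  rewrite addSnnS fi exprS.
  have : (i + j.+1)`!%:R != 0 :> R by rewrite pnatr_eq0 -lt0n fact_gt0.
  move: i0; move: (i.+1%:R) ((i + j.+1)`!%:R) (i`!%:R) => a b c a0 b0.
  by field; rewrite a0 b0.
rewrite IHn big_ord_recl /= expr0 addn0 divff ?mul1r; last first.
  by rewrite pnatr_eq0 -lt0n fact_gt0.
rewrite mulrDr mulrA step -addrA; congr (1 + (_ + _)).
by rewrite mulr_sumr; apply: eq_bigr => j _; rewrite step.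
Qed.

Lemma exp_hornerE1 x n r :
  exp_horner x n 1 r = series (exp_coeff x) n + exp_coeff x n * r.
Proof.
rewrite exp_hornerE /series /= big_mkord /exp_coeff /=; congr (_ + _).
  by apply: eq_bigr => j _; rewrite fact0 add0n mul1r.
by rewrite fact0 add0n mul1r.
Qed.

Lemma ler_exp_horner x n i r s : 0 <= x -> r <= s ->
  exp_horner x n i r <= exp_horner x n i s.
Proof.
move=> x0 rs; elim: n i => [|n IHn] i //=.
by rewrite lerD2l ler_wpM2l// divr_ge0.
Qed.

Let ler_series_exp x n : 0 <= x -> series (exp_coeff x) n <= expR x.
Proof.
move=> x0; apply: nondecreasing_cvgn_le; last exact: is_cvg_series_exp_coeff.
by apply: nondecreasing_series => k _ _; exact: exp_coeff_ge0.
Qed.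

Lemma expR_ge_horner x n : 0 <= x -> exp_horner x n 1 1 <= expR x.
Proof.
move=> x0; rewrite exp_hornerE1 mulr1 (le_trans _ (ler_series_exp n.+1 x0))//.
by rewrite /series /= big_nat_recr.
Qed.

(** Since n! j! <= (n + j)!, the series from index n on is at most x^n / n! times the whole
    series. *)
Lemma expR_le_horner x n : 0 <= x -> expR x <= exp_horner x n 1 (expR x).
Proof.
move=> x0; rewrite exp_hornerE1.
apply: limr_le; first exact: is_cvg_series_exp_coeff.
near=> N.
have nN : (n <= N)%N by near: N; exact: nbhs_infty_ge.
rewrite -(subnKC nN) /series /= (@big_cat_nat _ _ _ n)//= ?leq_addr//.
rewrite lerD2l.
have := ler_wpM2l (exp_coeff_ge0 n x0) (ler_series_exp (N - n) x0).
apply: le_trans.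
rewrite /series /= mulr_sumr -{1}[n]add0n big_addn addKn ler_sum// => j _.
rewrite /exp_coeff /= mulf_div -exprD [(j + n)%N]addnC ler_wpM2l ?exprn_ge0//.
rewrite lef_pV2 ?posrE -?natrM ?ltr0n ?muln_gt0 ?fact_gt0// ler_nat.
rewrite -(bin_fact (leq_addr j n)) addKn -[leqLHS]mul1n leq_mul2r.
by rewrite bin_gt0 leq_addr orbT.
Unshelve. all: by end_near. Qed.

(* Here 12 bounds expR x, by expR (- x) >= 1 - x. *)
Lemma expR_le_horner12 x n : 0 <= x <= 11 / 12 ->
  expR x <= exp_horner x n 1 12.
Proof.
move=> /andP[x0 x1]; apply: (le_trans (expR_le_horner n x0)).
apply: ler_exp_horner => //.
have := expR_ge1Dx (- x); rewrite expRN => h.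
have e0 := expR_gt0 x.
have : 12^-1 <= (expR x)^-1 by lra.
by rewrite lef_pV2// posrE.
Qed.

End ExpBounds.

(** * Convexity, roots and numerics of the moment function *)

Section MomentFunction.
Context {R : realType}.
Implicit Types x y t : R.

(** The derivative of [M5_RRW]. At a root it is also the mean fall per step under the tilted law. *)
Definition M5_slope t : R :=
  2^-1 * (ln 2 * expR (t * ln 2) - ln (5 / 2) * expR (- (t * ln (5 / 2)))).

Lemma M5E t : M5_RRW t = 2^-1 * (expR (t * ln 2) + expR (- (t * ln (5 / 2)))).
Proof.
rewrite /M5_RRW /powR !gt_eqF//=; congr (_ * (_ + expR _)).
have -> : 2 / 5 = (5 / 2)^-1 :> R by lra.
by rewrite lnV ?mulrN// posrE; lra.
Qed.

Lemma M5_0 : M5_RRW 0 = 1 :> R.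
Proof. by rewrite /M5_RRW !powRr0; lra. Qed.

Lemma expR_tangent x y : x != y -> expR y * (1 + (x - y)) < expR x.
Proof.
move=> xy; have -> : expR x = expR y * expR (x - y) by rewrite -expRD subrKC.
by rewrite ltr_pM2l ?expR_gt0// expR_gt1Dx// subr_eq0.
Qed.

Let ln2_gt0 : 0 < ln 2 :> R. Proof. by apply: ln_gt0; lra. Qed.
Let ln52_gt0 : 0 < ln (5 / 2) :> R. Proof. by apply: ln_gt0; lra. Qed.

(** Strict convexity in tangent form, the sum of the strict tangent inequalities of the two
    exponentials. *)
Lemma M5_tangent x y : x != y -> M5_RRW y + M5_slope y * (x - y) < M5_RRW x.
Proof.
move=> xy; rewrite !M5E /M5_slope.
have h1 : x * ln 2 != y * ln 2 by rewrite (inj_eq (mulIf (lt0r_neq0 ln2_gt0))).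
have h2 : - (x * ln (5 / 2)) != - (y * ln (5 / 2)).
  by rewrite eqr_opp (inj_eq (mulIf (lt0r_neq0 ln52_gt0))).
have := expR_tangent h1; have := expR_tangent h2.
move: (expR _) (expR _) (expR _) (expR _) => u v w z; lra.
Qed.

(** The tangent at x is compared with the values at 0 and t; the weights t - x and x cancel the
    slope. *)
Lemma M5_lt1 t x : M5_RRW t = 1 -> 0 < x < t -> M5_RRW x < 1.
Proof.
move=> Mt /andP[x0 xt].
have := @M5_tangent 0 x; rewrite lt_eqF// M5_0 => /(_ isT) h0.
have := @M5_tangent t x; rewrite gt_eqF// Mt => /(_ isT) ht.
have d0 : 0 < t - x by lra.
move: h0; rewrite -(ltr_pM2l d0) => h0; move: ht; rewrite -(ltr_pM2l x0) => ht.
have : 0 < t * (1 - M5_RRW x) by lra.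
by rewrite pmulr_rgt0; lra.
Qed.

Lemma M5_slope_gt0 t : M5_RRW t = 1 -> 0 < t -> 0 < M5_slope t.
Proof.
move=> Mt t0; have := @M5_tangent 0 t; rewrite lt_eqF// M5_0 Mt => /(_ isT) h.
have : 0 < t * M5_slope t by lra.
by rewrite pmulr_rgt0.
Qed.

(** The tangent at the middle root would need a slope both negative and positive. *)
Lemma M5_no_three_roots x y z : M5_RRW x = 1 -> M5_RRW y = 1 ->
  M5_RRW z = 1 -> x < y < z -> False.
Proof.
move=> Mx My Mz /andP[xy yz].
have := @M5_tangent x y; rewrite lt_eqF// Mx My => /(_ isT).
have := @M5_tangent z y; rewrite gt_eqF// Mz My => /(_ isT).
rewrite gtrDl => hz; rewrite gtrDl => hx.
have : M5_slope y < 0 by move: hz; rewrite pmulr_llt0; lra.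
by move=> s0; move: hx; rewrite nmulr_llt0; lra.
Qed.

Lemma M5_roots t : 0 < t -> M5_RRW t = 1 ->
  forall x, M5_RRW x = 1 <-> x = 0 \/ x = t.
Proof.
move=> t0 Mt x; split=> [Mx|[->|->]//]; last exact: M5_0.
have n3 := M5_no_three_roots.
have [x0|x0|->] := ltgtP x 0; last by left.
  by case: (n3 _ _ _ Mx M5_0 Mt); rewrite x0.
have [xt|xt|->] := ltgtP x t; last by right.
  by case: (n3 _ _ _ M5_0 Mx Mt); rewrite x0.
by case: (n3 _ _ _ M5_0 Mt Mx); rewrite t0.
Qed.

Lemma M5_continuous : continuous (@M5_RRW R).
Proof.
move=> t; rewrite (_ : @M5_RRW R =
  fun t => 2^-1 * (expR (t * ln 2) + expR (- (t * ln (5 / 2))))); last first.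
  by apply/funext => x; rewrite M5E.
apply: cvgM; first exact: cvg_cst.
apply: cvgD.
  apply: continuous_comp; last exact: continuous_expR.
  by apply: cvgM; [exact: cvg_id|exact: cvg_cst].
apply: continuous_comp; last exact: continuous_expR.
by apply: cvgN; apply: cvgM; [exact: cvg_id|exact: cvg_cst].
Qed.

(* Groups of three digits keep the unary numerals small. *)
Definition dec4 (a b c d : nat) : R :=
  a%:R / 10 ^+ 3 + b%:R / 10 ^+ 6 + c%:R / 10 ^+ 9 + d%:R / 10 ^+ 12.

Let ln2_le : ln 2 <= dec4 693 147 180 600.
Proof.
rewrite -ler_expR lnK ?posrE//; apply: le_trans (expR_ge_horner 12 _).
  by rewrite /exp_horner /dec4; lra.
by rewrite /dec4; lra.
Qed.

Let ln2_ge : dec4 693 147 180 500 <= ln 2.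
Proof.
rewrite -ler_expR [leRHS]lnK ?posrE//; apply: (le_trans (expR_le_horner12 13 _)).
  by rewrite /dec4; lra.
by rewrite /exp_horner /dec4; lra.
Qed.

Let ln52_le : ln (5 / 2) <= dec4 916 290 731 900.
Proof.
rewrite -ler_expR lnK ?posrE; last by lra.
apply: le_trans (expR_ge_horner 13 _).
  by rewrite /exp_horner /dec4; lra.
by rewrite /dec4; lra.
Qed.

Let ln52_ge : dec4 916 290 731 800 <= ln (5 / 2).
Proof.
rewrite -ler_expR [leRHS]lnK ?posrE; last by lra.
apply: (le_trans (expR_le_horner12 15 _)).
  by rewrite /dec4; lra.
by rewrite /exp_horner /dec4; lra.
Qed.

Definition theta_lo : R := (349 * 10 ^+ 4 + 812) / 10 ^+ 7.
Definition theta_hi : R := (349 * 10 ^+ 4 + 814) / 10 ^+ 7.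

(** The Horner bounds require a nonnegative argument, so the decreasing exponential is bounded
    through its reciprocal. *)
Lemma M5_theta_lo : M5_RRW theta_lo < 1.
Proof.
rewrite M5E; set t := theta_lo.
have t0 : 0 < t by rewrite /t /theta_lo; lra.
have h1 : expR (t * ln 2) <= dec4 1273 749 170 0.
  apply: (@le_trans _ _ (expR (dec4 241 964 649 700))).
    rewrite ler_expR; apply: le_trans (ler_wpM2l (ltW t0) ln2_le) _.
    by rewrite /t /theta_lo /dec4; lra.
  apply: (le_trans (expR_le_horner12 10 _)).
    by rewrite /dec4; lra.
  by rewrite /exp_horner /dec4; lra.
have h2 : dec4 1376 934 790 0 <= expR (t * ln (5 / 2)).
  apply: (@le_trans _ _ (expR (dec4 319 859 868 0))); last first.
    rewrite ler_expR; apply: le_trans (ler_wpM2l (ltW t0) ln52_ge).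
    by rewrite /t /theta_lo /dec4; lra.
  apply: le_trans (expR_ge_horner 10 _).
    by rewrite /exp_horner /dec4; lra.
  by rewrite /dec4; lra.
have h3 : expR (- (t * ln (5 / 2))) <= (dec4 1376 934 790 0)^-1.
  by rewrite expRN lef_pV2 ?posrE ?expR_gt0// /dec4; lra.
apply: (@le_lt_trans _ _
  (2^-1 * (dec4 1273 749 170 0 + (dec4 1376 934 790 0)^-1))).
  by rewrite ler_pM2l ?lerD//; lra.
have d0 : 0 < dec4 1376 934 790 0 by rewrite /dec4; lra.
rewrite -(ltr_pM2l d0).
have -> : dec4 1376 934 790 0 *
    (2^-1 * (dec4 1273 749 170 0 + (dec4 1376 934 790 0)^-1)) =
  2^-1 * (dec4 1376 934 790 0 * dec4 1273 749 170 0 + 1).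
  by field; rewrite gt_eqF.
by rewrite /dec4; lra.
Qed.

Lemma M5_theta_hi : 1 < M5_RRW theta_hi.
Proof.
rewrite M5E; set t := theta_hi.
have t0 : 0 < t by rewrite /t /theta_hi; lra.
have h1 : dec4 1273 749 340 800 <= expR (t * ln 2).
  apply: (@le_trans _ _ (expR (dec4 241 964 788 100))); last first.
    rewrite ler_expR; apply: le_trans (ler_wpM2l (ltW t0) ln2_ge).
    by rewrite /t /theta_hi /dec4; lra.
  apply: le_trans (expR_ge_horner 10 _).
    by rewrite /exp_horner /dec4; lra.
  by rewrite /dec4; lra.
have h2 : expR (t * ln (5 / 2)) <= dec4 1376 935 51 0.
  apply: (@le_trans _ _ (expR (dec4 319 860 51 600))).
    rewrite ler_expR; apply: le_trans (ler_wpM2l (ltW t0) ln52_le) _.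
    by rewrite /t /theta_hi /dec4; lra.
  apply: (le_trans (expR_le_horner12 12 _)).
    by rewrite /dec4; lra.
  by rewrite /exp_horner /dec4; lra.
have d0 : 0 < dec4 1376 935 51 0 by rewrite /dec4; lra.
have h3 : (dec4 1376 935 51 0)^-1 <= expR (- (t * ln (5 / 2))).
  by rewrite expRN lef_pV2 ?posrE ?expR_gt0.
apply: (@lt_le_trans _ _
  (2^-1 * (dec4 1273 749 340 800 + (dec4 1376 935 51 0)^-1))); last first.
  by rewrite ler_pM2l ?lerD//; lra.
rewrite -(ltr_pM2l d0).
have -> : dec4 1376 935 51 0 *
    (2^-1 * (dec4 1273 749 340 800 + (dec4 1376 935 51 0)^-1)) =
  2^-1 * (dec4 1376 935 51 0 * dec4 1273 749 340 800 + 1).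
  by field; rewrite gt_eqF.
by rewrite /dec4; lra.
Qed.

Lemma M5_root_exists : exists2 t, M5_RRW t = 1 & theta_lo < t < theta_hi.
Proof.
have lh : theta_lo <= theta_hi by rewrite /theta_lo /theta_hi; lra.
have [||t /[!in_itv]/= /andP[lt th] Mt] := @IVT R (@M5_RRW R) theta_lo theta_hi 1 lh.
- by apply: continuous_subspaceT => x; exact: M5_continuous.
- rewrite /Order.min /Order.max.
  have lt12 := lt_trans M5_theta_lo M5_theta_hi.
  by rewrite lt12 !ltW ?M5_theta_lo ?M5_theta_hi.
exists t => //; rewrite !lt_neqAle lt th !andbT; apply/andP; split; apply/eqP.
  by move=> E; have := M5_theta_lo; rewrite E Mt ltxx.
by move=> E; have := M5_theta_hi; rewrite -E Mt ltxx.
Qed.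

End MomentFunction.

(** * The mode of a binomial law *)

Section BinomialMode.
Context {R : realType}.
Variables (p : R) (k : nat).
Hypothesis p01 : 0 < p < 1.

Let a (b : nat) : R := 'C(k, b)%:R * (p ^+ b * (1 - p) ^+ (k - b)).

Let q_gt0 : 0 < 1 - p. Proof. by case/andP: p01 => _ ?; rewrite subr_gt0. Qed.
Let p_gt0 : 0 < p. Proof. by case/andP: p01. Qed.

Let a_gt0 b : (b <= k)%N -> 0 < a b.
Proof.
by move=> bk; rewrite mulr_gt0 ?ltr0n ?bin_gt0// mulr_gt0 ?exprn_gt0.
Qed.

Let a_sum : \sum_(b < k.+1) a b = 1.
Proof.
transitivity ((1 - p + p) ^+ k); last by rewrite subrK expr1n.
by rewrite exprDn; apply: eq_bigr => i _; rewrite /a mulr_natl mulrC.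
Qed.

Let a_step b : (b < k)%N ->
  b.+1%:R * (1 - p) * a b.+1 = (k%:R - b%:R) * p * a b.
Proof.
move=> bk; rewrite /a -natrB 1?ltnW//.
have := congr1 (fun m => m%:R : R) (mul_bin_left k b); rewrite !natrM => E.
have -> : (1 - p) ^+ (k - b) = (1 - p) * (1 - p) ^+ (k - b.+1).
  by rewrite -exprS -subSn.
rewrite exprS.
transitivity (b.+1%:R * 'C(k, b.+1)%:R *
  ((1 - p) * p * p ^+ b * (1 - p) ^+ (k - b.+1))); first by ring.
by rewrite E; ring.
Qed.

(** The largest of k + 1 masses with sum 1 is at least their average. Comparing it with its two
    neighbours through the ratio in [a_step] locates the mode. *)
Lemma binomial_mode : exists b : nat,
  [/\ (b <= k)%N, k.+1%:R * p - 1 <= b%:R <= k.+1%:R * p &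
      k.+1%:R^-1 <= 'C(k, b)%:R * (p ^+ b * (1 - p) ^+ (k - b))].
Proof.
case: (@arg_maxP _ R 'I_k.+1 ord0 xpredT (fun b => a b)) => // b _ bmax.
have bk : (b <= k)%N by rewrite -ltnS.
have k1 : k.+1%:R = k%:R + 1 :> R by rewrite natr1.
exists b; split => //; last first.
  rewrite -/(a b) -[leLHS]mul1r -[X in X / _]a_sum ler_pdivrMr ?ltr0n//.
  have : \sum_(i < k.+1) a i <= \sum_(i < k.+1) a b by apply: ler_sum.
  by rewrite big_const_ord iter_addr_0 mulr_natr.
have ab := a_gt0 bk.
apply/andP; split.
  have [bk'|kb] := ltnP b k; last first.
    (* At b = k there is no right neighbour, and the bound reduces to p <= 1. *)
    have -> : b%:R = k%:R :> R by congr _%:R; apply/eqP; rewrite eqn_leq bk kb.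
    have := mulr_ge0 (ler0n R k.+1) (ltW q_gt0); rewrite k1; lra.
  have hb : (b.+1 < k.+1)%N by [].
  have := bmax (Ordinal hb) isT; rewrite /= => hle.
  have : (k%:R - b%:R) * p * a b <= b.+1%:R * (1 - p) * a b.
    by rewrite -a_step// ler_wpM2l// mulr_ge0// ltW.
  by rewrite ler_pM2r// k1 -[b.+1%:R]natr1; lra.
case: b bmax bk ab => -[|c] /= ck bmax bk ab.
  by rewrite mulr_ge0// ltW.
have := bmax (Ordinal (ltnW ck)) isT; rewrite /= => hle.
have : c.+1%:R * (1 - p) * a c.+1 <= (k%:R - c%:R) * p * a c.+1.
  by rewrite a_step// ler_wpM2l// mulr_ge0 ?(ltW p_gt0)// subr_ge0 ler_nat ltnW.
by rewrite ler_pM2r// k1 -[c.+1%:R]natr1; lra.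
Qed.

End BinomialMode.

(** * Counting step sets by their fall *)

Section WalkCounting.
Context {R : realType}.
Implicit Types (x t : R) (k : nat).

Let ln52 : ln (5 / 2) = ln 5 - ln 2 :> R.
Proof. by rewrite ln_div// posrE. Qed.

Let ln5_ge0 : 0 <= ln 5 :> R. Proof. by apply: ln_ge0; lra. Qed.

(* Minus the displacement after k steps, when the steps in s go up. *)
Definition fall k (s : {set 'I_k}) : R := k%:R * ln 2 - #|s|%:R * ln 5.

Lemma fallE k (s : {set 'I_k}) :
  fall s = \sum_(i < k) (ln 2 - (i \in s)%:R * ln 5).
Proof.
rewrite /fall mulr_natl big_split /= sumr_const card_ord sumrN -mulr_suml.
rewrite -sum1_card natr_sum big_mkcond; congr (_ - _ * _).
by apply: eq_bigr => i _; case: (i \in s).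
Qed.

(** The exponential factors over the steps: a downward step contributes 2^t and an upward one
    (2/5)^t, so the sum over subsets is a k-th power. *)
Lemma sum_expR_fall k t :
  \sum_(s : {set 'I_k}) expR (t * fall s) = (2 * M5_RRW t) ^+ k.
Proof.
rewrite M5E mulVKf// ln52 -[X in _ ^+ X](card_ord k) -prodr_const.
under [RHS]eq_bigr do rewrite addrC.
rewrite bigA_distr; apply: eq_big => [s|s _]; first by rewrite inE.
rewrite fallE mulr_sumr expR_sum; apply: eq_bigr => i _.
by case: (i \in s); rewrite /= ?mul1r ?mul0r; congr expR; ring.
Qed.

(** Exponential Markov inequality: the indicator of x <= [fall s] is at most e^(t ([fall s] -
    x)). *)
Lemma card_fall_ge k t x : 0 <= t ->
  #|[set s : {set 'I_k} | x <= fall s]%SET|%:R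
    <= 2 ^+ k * (expR (- (t * x)) * M5_RRW t ^+ k).
Proof.
move=> t0.
rewrite mulrCA -exprMn -sum_expR_fall mulr_sumr -sum1_card natr_sum big_mkcond.
apply: ler_sum => s _; rewrite inE.
case: ifPn => [xs|_]; last by rewrite mulr_ge0 ?expR_ge0.
rewrite -expRD; apply: le_trans (expR_ge1Dx _).
by have := ler_wpM2l t0 xs; lra.
Qed.

(** Only sets of the modal size b are counted. Their tilted weight is 2^(-k) e^(t [fall s]), so the
    mass of the mode bounds 'C(k, b) from below. As b is within 1 of (k + 1) p, their fall differs
    from k [M5_slope t] by at most ln 5. *)
Lemma card_fall_ge_lower k t : M5_RRW t = 1 -> 0 < t ->
  2 ^+ k * (k.+1%:R^-1 * expR (- (t * (k%:R * M5_slope t + ln 5))))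
    <= #|[set s : {set 'I_k} | k%:R * M5_slope t - ln 5 <= fall s]%SET|%:R.
Proof.
move=> Mt t0.
pose p : R := 2^-1 * expR (- (t * ln (5 / 2))).
have p0 : 0 < p by rewrite mulr_gt0// expR_gt0.
have q0 : 0 < 2^-1 * expR (t * ln 2) by rewrite mulr_gt0// expR_gt0.
have pq : 1 - p = 2^-1 * expR (t * ln 2) by move: Mt; rewrite M5E /p; lra.
have p01 : 0 < p < 1 by rewrite p0 -subr_gt0 pq.
have slopeE : M5_slope t = ln 2 - p * ln 5.
  transitivity (ln 2 * (1 - p) - (ln 5 - ln 2) * p); last by ring.
  by rewrite pq /M5_slope /p ln52; ring.
have [b [bk /andP[b1 b2] hb]] := binomial_mode k p01.
have pqE : p ^+ b * (1 - p) ^+ (k - b) =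
    2 ^- k * expR (t * (k%:R * ln 2 - b%:R * ln 5)).
  rewrite pq !exprMn -!expRM_natl mulrACA -exprD subnKC// -expRD exprVn.
  by rewrite natrB// ln52; congr (_ * expR _); ring.
have hC : 2 ^+ k * (k.+1%:R^-1 * expR (- (t * (k%:R * ln 2 - b%:R * ln 5))))
    <= 'C(k, b)%:R.
  have e0 := expR_gt0 (t * (k%:R * ln 2 - b%:R * ln 5)).
  move: hb; rewrite pqE expRN => hb.
  rewrite mulrA ler_pdivrMr// -ler_pdivlMl ?exprn_gt0//.
  by apply: le_trans hb _; rewrite mulrCA mulrC.
apply: le_trans (le_trans hC _).
  rewrite ler_pM2l ?exprn_gt0// ler_pM2l ?invr_gt0 ?ltr0n// ler_expR lerN2.
  rewrite ler_pM2l// slopeE.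
  have := ler_wpM2r ln5_ge0 b1; have := mulr_ge0 (ltW p0) ln5_ge0.
  by rewrite -natr1; lra.
rewrite ler_nat -{1}(card_ord k) -card_draws subset_leq_card//.
apply/fintype.subsetP => s; rewrite !inE => /eqP sb; rewrite /fall sb slopeE.
have := ler_wpM2r ln5_ge0 b2; have : 0 <= (1 - p) * ln 5.
  by rewrite mulr_ge0// pq ltW.
by rewrite -natr1; lra.
Qed.

End WalkCounting.

(** * Outer bounds on probabilities *)

Section OuterProbability.
Context {R : realType} {d : measure_display} {T : measurableType d}.
Variable P : probability T R.
Implicit Types (A : set T) (e : R).

(** Bounding through a measurable superset avoids proving measurability of events such as those
    built from [good]. *)
Definition outer_le A e :=
  exists B, [/\ measurable B, A `<=` B & (P B <= e%:E)%E].

Lemma outer_le_sub A A' e : A `<=` A' -> outer_le A' e -> outer_le A e.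
Proof. by move=> sAA' [B [mB sAB Be]]; exists B; split => // x /sAA' /sAB. Qed.

Lemma outer_le_trans A e e' : e <= e' -> outer_le A e -> outer_le A e'.
Proof.
move=> ee' [B [mB AB Be]]; exists B; split => //.
by rewrite (le_trans Be)// lee_fin.
Qed.

Lemma outer_le_bigcup (A : nat -> set T) (e : nat -> R) (s : R) :
  (forall n, outer_le (A n) (e n)) ->
  (forall N, \sum_(0 <= n < N) e n <= s) -> outer_le (\bigcup_n A n) s.
Proof.
move=> /(_ _)/cid - /all_sig[B /all_and3[mB AB Be]] es.
exists (\bigcup_n B n); split; first exact: bigcup_measurable.
  by apply: subset_bigcup => n _; exact: AB.
apply: (le_trans (measure_sigma_subadditive _ mB _ (@subset_refl _ _))).
  exact: bigcup_measurable.
apply: lime_le; first by apply: is_cvg_nneseries => *; exact: measure_ge0.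
near=> N; apply: (@le_trans _ _ (\sum_(0 <= n < N) (e n)%:E)%E).
  by apply: lee_sum => n _; exact: Be.
by rewrite sumEFin lee_fin.
Unshelve. all: by end_near. Qed.

Lemma outer_le_negligible A :
  (forall e, 0 < e -> outer_le A e) -> P.-negligible A.
Proof.
move=> h; have {}h n : outer_le A n.+1%:R^-1 by apply: h; rewrite invr_gt0.
move: h => /(_ _)/cid - /all_sig[B /all_and3[mB AB Be]].
exists (\bigcap_n B n); split.
- exact: bigcap_measurable.
- apply/eqP; rewrite eq_le measure_ge0 andbT; apply/lee_addgt0Pr => e e0.
  have [n ne] : exists n, n.+1%:R^-1 <= e.
    exists (Num.truncn e^-1); rewrite -[leRHS]invrK lef_pV2 ?posrE ?invr_gt0//.
    by rewrite ltW// truncnS_gt.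
  rewrite add0e (@le_trans _ _ (n.+1%:R^-1)%:E) ?lee_fin//.
  apply: le_trans (Be n); apply: le_measure; rewrite ?inE//.
    exact: bigcap_measurable.
  by move=> x; apply.
- by move=> x Ax n _; exact: AB.
Qed.

Lemma outer_le_ae A :
  (forall e, 0 < e -> outer_le A e) -> \forall w \ae P, ~ A w.
Proof.
move=> /outer_le_negligible nA; rewrite /prop_near1 /= /nbhs /=.
by apply: negligibleS nA => w /= /contrapT.
Qed.

End OuterProbability.

Lemma measure_bigsetU_le (R : realType) (d : measure_display)
    (T : measurableType d) (mu : {measure set T -> \bar R}) (I : Type)
    (s : seq I) (A : I -> set T) : (forall i, measurable (A i)) ->
  (mu (\big[setU/set0]_(i <- s) A i) <= \sum_(i <- s) mu (A i))%E.
Proof.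
move=> mA; elim: s => [|i s IHs]; first by rewrite !big_nil measure0.
rewrite !big_cons (le_trans (measureU2 _ _ _))//; first exact: bigsetU_measurable.
by rewrite leeD2l.
Qed.

(** * From the random walks to step sets *)

Section Walks.
Context {R : realType} {d : measure_display} {T : measurableType d}.
Variables (P : probability T R) (delta : nat -> nat -> {RV P >-> R}).
Hypothesis hmodel : rrw_model delta.

(** The law fixes the values of [delta] only almost surely; on this set the upward steps determine
    the walk. *)
Definition good : set T := [set w | forall i n, (0 < i)%N -> (0 < n)%N ->
  delta i n w = 0 \/ delta i n w = 1].

Lemma ae_good : \forall w \ae P, good w.
Proof.
suff h i n : \forall w \ae P,
    (0 < i)%N -> (0 < n)%N -> delta i n w = 0 \/ delta i n w = 1.
  have := ae_foralln (fun i => ae_foralln (h i)).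
  by apply: filterS => w hw i n; exact: hw.
have [i0|] := boolP (0 < i)%N; last by move=> _; exact: aeW.
have [n0|] := boolP (0 < n)%N; last by move=> _; exact: aeW.
have [[h0 h1]] := (hmodel.1 i n i0 n0).
have m0 := measurable_funPTI (delta i n) (measurable_set1 (0 : R)).
have m1 := measurable_funPTI (delta i n) (measurable_set1 (1 : R)).
exists (~` (delta i n @^-1` [set 0] `|` delta i n @^-1` [set 1])); split.
- by apply: measurableC; exact: measurableU.
- rewrite probability_setC; last exact: measurableU.
  rewrite measureU//; last first.
    rewrite -preimage_setI (_ : [set 0] `&` [set 1] = set0) ?preimage_set0//.
    by apply/seteqP; split => // x [/= ->] /eqP; rewrite eq_sym oner_eq0.
  apply: (eq_trans (f_equal2 (fun x y : \bar R => (1 - (x + y))%E) h0 h1)).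
  have -> : ((2^-1)%:E + (2^-1)%:E = 1 :> \bar R)%E.
    by rewrite -EFinD; congr EFin; lra.
  by rewrite -EFinB subrr.
- by move=> w /= /not_implyP[_ /not_implyP[_ nw]] [] dw; apply: nw; [left|right].
Qed.

(** Elements of 'I_k start from 0 and steps from 1, hence the shift. *)
Definition ups k n w : {set 'I_k} := [set i : 'I_k | delta i.+1 n w == 1]%SET.

Lemma good_delta w i n : good w -> (0 < i)%N -> (0 < n)%N ->
  delta i n w = (delta i n w == 1)%:R.
Proof.
move=> gw i0 n0; case: (gw i n i0 n0) => ->; last by rewrite eqxx.
by rewrite eq_sym oner_eq0.
Qed.

Lemma Z5_good w k n : good w -> (0 < n)%N ->
  Z5 delta k n w = ln n%:R - fall (ups k n w).
Proof.
move=> gw n0; rewrite /Z5 fallE -sumrN big_add1 /= big_mkord.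
congr (_ + _); apply: eq_bigr => i _.
by rewrite inE /W5 opprB addrC {1}(good_delta gw).
Qed.

Lemma prob_cylinder (J : {fset nat * nat}) (c : nat * nat -> bool) :
  (forall p, p \in J -> (0 < p.1)%N /\ (0 < p.2)%N) ->
  P (\bigcap_(p in [set` J]) delta p.1 p.2 @^-1` [set (c p)%:R])
    = (2^-1 ^+ #|` J|)%:E.
Proof.
move=> J0; rewrite (hmodel.2 J (fun p => [set (c p)%:R]))//.
rewrite (eq_big_seq (fun=> (2^-1)%:E)); last first.
  by move=> p /J0[p1 p2]; have [h0 h1] := hmodel.1 _ _ p1 p2; case: (c p).
by rewrite prodEFin big_const_seq count_predT iter_mulr_1 cardfE.
Qed.

(** Union bound over the #|F|^(N + 1) choices of one step set in F per walk; by independence each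
    choice is a cylinder of probability 2^(-(k + 1)(N + 1)). *)
Lemma outer_le_block k N m (F : {set {set 'I_k.+1}}) : (0 < m)%N ->
  outer_le P
    [set w | good w /\ forall j : 'I_N.+1, ups k.+1 (m + j) w \in F]
    ((#|F|%:R / 2 ^+ k.+1) ^+ N.+1).
Proof.
move=> m0.
pose f (u : 'I_k.+1 * 'I_N.+1) := (u.1.+1, (m + u.2)%N).
have f_inj : injective f.
  move=> [i j] [i' j'] [] /val_inj -> /eqP.
  by rewrite eqn_add2l => /eqP /val_inj ->.
pose J := [fset f u | u in {: 'I_k.+1 * 'I_N.+1}]%fset.
have cardJ : #|` J| = (k.+1 * N.+1)%N.
  by rewrite card_imfset//= -cardE card_prod !card_ord.
(* Decodes a pair of [J] into a step and a walk; values outside [J] are junk and never read. *)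
pose c (phi : {ffun 'I_N.+1 -> {set 'I_k.+1}}) (p : nat * nat) :=
  inord p.1.-1 \in phi (inord (p.2 - m)).
pose C phi := \bigcap_(p in [set` J]) delta p.1 p.2 @^-1` [set (c phi p)%:R].
have J0 p : p \in J -> (0 < p.1)%N /\ (0 < p.2)%N.
  by move=> /imfsetP[u _ ->]; rewrite /= addn_gt0 m0.
have mC phi : measurable (C phi).
  apply: fin_bigcap_measurable => [|p _]; first exact: finite_fset.
  exact: (measurable_funPTI (delta p.1 p.2) (measurable_set1 _)).
pose s := enum (ffun_on (mem F) : {pred {ffun 'I_N.+1 -> {set 'I_k.+1}}}).
exists (\big[setU/set0]_(phi <- s) C phi); split.
- exact: bigsetU_measurable.
- move=> w [gw wF]; rewrite -bigcup_seq.
  exists [ffun j : 'I_N.+1 => ups k.+1 (m + j) w].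
    rewrite /= mem_enum; apply/ffun_onP => j; rewrite ffunE; exact: wF.
  move=> _ /imfsetP[[i j] _ ->]; rewrite /C /c /f /= ffunE inE.
  by rewrite addKn !inord_val -good_delta// addn_gt0 m0.
- apply: (le_trans (@measure_bigsetU_le _ _ _ P _ s C mC)).
  rewrite (eq_bigr _ (fun phi _ => prob_cylinder (c phi) J0)).
  rewrite sumEFin lee_fin big_const_seq count_predT iter_addr_0 -cardE.
  rewrite card_ffun_on card_ord cardJ -[leLHS]mulr_natl natrX exprM -exprMn exprVn.
  exact: lexx.
Qed.

Lemma outer_le_tail k n (x t : R) : (0 < n)%N -> 0 <= t ->
  outer_le P [set w | good w /\ Z5 delta k.+1 n w <= ln n%:R - x]
    (expR (- (t * x)) * M5_RRW t ^+ k.+1).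
Proof.
move=> n0 t0.
apply: (outer_le_trans _ (outer_le_sub _
  (@outer_le_block k 0 n [set s : {set 'I_k.+1} | x <= fall s]%SET n0)));
  last first.
  move=> w [gw hw]; split=> // j; rewrite inE ord1 addn0.
  by move: hw; rewrite Z5_good// lerD2l lerN2.
rewrite expr1 ler_pdivrMr ?exprn_gt0// mulrC; exact: card_fall_ge.
Qed.

End Walks.

(** * Elementary series estimates *)

Section Estimates.
Context {R : realType}.

Lemma geometric_sum_le (r : R) N : 0 <= r < 1 ->
  \sum_(0 <= k < N) r ^+ k <= (1 - r)^-1.
Proof.
move=> /andP[r0 r1]; have q0 : 0 < 1 - r by rewrite subr_gt0.
rewrite -[leRHS]mul1r ler_pdivlMr// mulr_suml.
rewrite (eq_bigr (fun k => - (r ^+ k.+1 - r ^+ k))); last first.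
  by move=> k _; rewrite exprS; ring.
by rewrite sumrN telescope_sumr// expr0 opprB gerBl exprn_ge0.
Qed.

Lemma expRN_le_inv (x : R) : 0 < x -> expR (- x) <= x^-1.
Proof.
move=> x0; rewrite expRN lef_pV2 ?posrE ?expR_gt0//.
by apply: le_trans (expR_ge1Dx x); lra.
Qed.

(* Telescoping form of the integral test for \sum n^-(1 + b). *)
Lemma riemann_telescope (b : R) n : 0 < b -> (0 < n)%N ->
  b * expR (- ((1 + b) * ln n.+1%:R)) <=
  expR (- (b * ln n%:R)) - expR (- (b * ln n.+1%:R)).
Proof.
move=> b0 n0.
have n0' : 0 < n%:R :> R by rewrite ltr0n.
have n1 : 0 < n.+1%:R :> R by rewrite ltr0n.
set u := ln n%:R; set v := ln n.+1%:R.
have uv : n.+1%:R^-1 <= v - u.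
  have := @le_ln1Dx R (- n.+1%:R^-1).
  have -> : 1 + - n.+1%:R^-1 = n%:R / n.+1%:R :> R.
    by rewrite -[X in X / _](addrK 1) natr1 mulrBl divff ?gt_eqF// mul1r.
  rewrite ln_div ?posrE// -/u -/v => h.
  have : u - v <= - n.+1%:R^-1.
    by apply: h; rewrite ltrN2 invf_lt1// ltr1n.
  by rewrite -[v - u]opprB lerNr.
have -> : expR (- (b * u)) = expR (- (b * v)) * expR (b * (v - u)).
  by rewrite -expRD; congr expR; ring.
have -> : expR (- ((1 + b) * v)) = expR (- (b * v)) * n.+1%:R^-1.
  by rewrite -[n.+1%:R^-1](lnK _) ?posrE ?invr_gt0// lnV// -expRD;
    congr expR; rewrite -/v; ring.
have := expR_ge1Dx (b * (v - u)) => h.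
set z := n.+1%:R^-1 in uv *.
have h2 : b * z <= expR (b * (v - u)) - 1.
  by have := ler_wpM2l (ltW b0) uv; lra.
by have := ler_wpM2l (expR_ge0 (- (b * v))) h2; lra.
Qed.

End Estimates.

(** * Almost sure bounds on the walks *)

Section AlmostSure.
Context {R : realType} {d : measure_display} {T : measurableType d}.
Variables (P : probability T R) (delta : nat -> nat -> {RV P >-> R}).
Hypothesis hmodel : rrw_model delta.
Variable theta : R.
Hypotheses (theta_gt0 : 0 < theta) (Mtheta : M5_RRW theta = 1).

(** Taking t strictly below theta makes the tail bounds geometric in the time [k], hence
    summable. *)
Lemma outer_le_dip n (x t : R) : (0 < n)%N -> 0 < t < theta ->
  outer_le P
    [set w | good delta w /\ exists k, Z5 delta k.+1 n w <= ln n%:R - x]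
    (expR (- (t * x)) * (1 - M5_RRW t)^-1).
Proof.
move=> n0 /andP[t0 tt].
have M1 : M5_RRW t < 1 by apply: M5_lt1 Mtheta _; rewrite t0.
have M0 : 0 <= M5_RRW t by rewrite M5E mulr_ge0// addr_ge0 ?expR_ge0.
apply: (@outer_le_sub _ _ _ _ _ (\bigcup_k
    [set w | good delta w /\ Z5 delta k.+1 n w <= ln n%:R - x])).
  by move=> w [gw [k kw]]; exists k.
apply: (outer_le_bigcup (fun k => outer_le_tail hmodel k x n0 (ltW t0))).
move=> N; rewrite -mulr_sumr ler_wpM2l ?expR_ge0//.
apply: (@le_trans _ _ (\sum_(0 <= k < N) M5_RRW t ^+ k)).
  by apply: ler_sum => k _; rewrite exprS ler_piMl ?exprn_ge0// ltW.
by apply: geometric_sum_le; rewrite M0.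
Qed.

Lemma ae_Z5_bounded_below n : (0 < n)%N ->
  \forall w \ae P, exists c : R, forall k, c <= Z5 delta k n w.
Proof.
move=> n0.
pose A := [set w | good delta w /\
  forall x : R, exists k, Z5 delta k.+1 n w <= ln n%:R - x].
have : \forall w \ae P, ~ A w.
  apply: outer_le_ae => e e0.
  pose t := theta / 2.
  have t01 : 0 < t < theta by rewrite /t divr_gt0//= gtr_pMr// invf_lt1// ltr1n.
  have [t0 _] := andP t01.
  have K0 : 0 < (1 - M5_RRW t)^-1.
    by rewrite invr_gt0 subr_gt0; exact: M5_lt1 Mtheta t01.
  set K := (1 - M5_RRW t)^-1 in K0.
  (* The depth K / e / t gives the bound K e^(- K / e), which is at most e. *)
  apply: outer_le_trans (outer_le_sub _
    (outer_le_dip (K / e / t) n0 t01)); last first.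
    by move=> w [gw hw]; split.
  rewrite -/K mulrCA divff ?gt_eqF// mulr1.
  have Ke : 0 < K / e by rewrite divr_gt0.
  have := ler_wpM2r (ltW K0) (expRN_le_inv Ke).
  by rewrite invf_div divfK ?gt_eqF.
move=> nA; have ag := ae_good hmodel; move: nA ag; apply: filterS2 => w nAw gw.
have [x hx] : exists x : R, forall k, ~ (Z5 delta k.+1 n w <= ln n%:R - x).
  apply: contrapT => h; apply: nAw; split => // x.
  apply: contrapT => hk; apply: h; exists x => k hk'; apply: hk.
  by exists k.
(* Dips are taken at times [k.+1], so time 0 enters through the minimum. *)
exists (Num.min (ln n%:R - x) (ln n%:R)) => -[|k].
  by rewrite /Z5 big_nil addr0 ge_min lexx orbT.
by rewrite ge_min ltW// ltNge; apply/negP.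
Qed.

(** First Borel-Cantelli argument done by hand: the dips of all walks starting above J have total
    probability at most e once J is large. *)
Lemma ae_eventually_ge (eps : R) : 0 < eps ->
  \forall w \ae P, exists N, forall n, (N <= n)%N -> forall k,
    (1 - theta^-1 - eps) * ln n%:R <= Z5 delta k n w.
Proof.
move=> eps0.
have th0 : 0 < theta^-1 by rewrite invr_gt0.
pose g := theta^-1 + eps.
pose A := [set w | good delta w /\ forall N, exists n, (N <= n)%N /\
  exists k, Z5 delta k.+1 n w <= ln n%:R - g * ln n%:R].
have : \forall w \ae P, ~ A w.
  apply: outer_le_ae => e e0.
  (* This t is below theta, yet t g > 1, so n^(- t g) is summable. *)
  pose t := (theta^-1 + eps / 2)^-1.
  have t01 : 0 < t < theta.
    have g0 : 0 < theta^-1 + eps / 2 by rewrite addr_gt0// divr_gt0.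
    rewrite invr_gt0 g0 -[X in _ < X]invrK ltf_pV2 ?posrE//.
    by rewrite ltrDl divr_gt0.
  have [t0 _] := andP t01.
  pose b := t * g - 1.
  have b0 : 0 < b.
    rewrite subr_gt0 /t /g mulrC ltr_pdivlMr ?mul1r; last by lra.
    by lra.
  have K0 : 0 < (1 - M5_RRW t)^-1.
    by rewrite invr_gt0 subr_gt0; exact: M5_lt1 Mtheta t01.
  set K := (1 - M5_RRW t)^-1 in K0.
  have y0 : 0 < K / b / e by rewrite !divr_gt0.
  (* The telescoped tail is at most K J^(- b) / b; this J makes J^(- b) at most b e / K. *)
  pose J := (Num.truncn (expR (K / b / e / b))).+1.
  have J0 : 0 < J%:R :> R by rewrite ltr0n.
  have lnJ : K / b / e <= b * ln J%:R.
    rewrite [b * _]mulrC -ler_pdivrMr// -ler_expR lnK ?posrE//.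
    by rewrite ltW// truncnS_gt.
  apply: (@outer_le_sub _ _ _ _ _ (\bigcup_i
    [set w | good delta w /\ exists k, Z5 delta k.+1 (J + i).+1 w <=
      ln (J + i).+1%:R - g * ln (J + i).+1%:R])).
    move=> w [gw hw]; have [n [Jn hn]] := hw J.+1.
    exists (n - J.+1)%N => //=; split => //.
    by rewrite -addSn subnKC.
  apply: (outer_le_bigcup (fun i => outer_le_dip _ (ltn0Sn (J + i)) t01)).
  move=> N; rewrite -/K -mulr_suml -ler_pdivlMr//.
  rewrite -(ler_pM2l b0) mulr_sumr.
  apply: (@le_trans _ _ (\sum_(0 <= i < N)
    - (expR (- (b * ln (J + i.+1)%:R)) - expR (- (b * ln (J + i)%:R))))).
    apply: ler_sum => i _; rewrite opprB addnS.
    apply: le_trans (riemann_telescope b0 _); last by rewrite addn_gt0.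
    rewrite ler_pM2l// ler_expR /b mulrA [1 + _]addrC subrK.
    exact: lexx.
  rewrite sumrN telescope_sumr// opprB addn0.
  apply: (@le_trans _ _ (expR (- (b * ln J%:R)))).
    by rewrite gerBl expR_ge0.
  apply: (@le_trans _ _ (expR (- (K / b / e)))).
    by rewrite ler_expR lerN2.
  apply: (le_trans (expRN_le_inv y0)).
  by rewrite !invf_div mulrCA.
move=> nA; have ag := ae_good hmodel; move: nA ag; apply: filterS2 => w nAw gw.
have [N hN] : exists N, forall n, (N <= n)%N -> forall k,
    ~ (Z5 delta k.+1 n w <= ln n%:R - g * ln n%:R).
  apply: contrapT => h; apply: nAw; split => // N.
  apply: contrapT => hk; apply: h; exists N => n Nn k hk'; apply: hk.
  by exists n; split => //; exists k.
exists N.+1 => n Nn.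
have n1 : (0 < n)%N by apply: leq_trans Nn.
have ln0 : 0 <= ln n%:R :> R by rewrite ln_ge0// ler1n.
case=> [|k].
  rewrite /Z5 big_nil addr0 -[leRHS]mul1r ler_wpM2r//; lra.
have -> : (1 - theta^-1 - eps) * ln n%:R = ln n%:R - g * ln n%:R.
  by rewrite /g; ring.
by rewrite ltW// ltNge; apply/negP; apply: hN; exact: ltnW.
Qed.

(** Complement of [card_fall_ge_lower], using 1 - p <= e^(- p). *)
Lemma card_fall_lt k :
  #|[set s : {set 'I_k} | ~~ (k%:R * M5_slope theta - ln 5 <= fall s)]%SET|%:R
    / 2 ^+ k <=
  expR (- (k.+1%:R^-1 * expR (- (theta * (k%:R * M5_slope theta + ln 5))))).
Proof.
set x := k%:R * _ - _; set p := k.+1%:R^-1 * _.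
pose F := [set s : {set 'I_k} | x <= fall s]%SET.
have -> : [set s : {set 'I_k} | ~~ (x <= fall s)]%SET = (~: F)%SET.
  by apply/setP => s; rewrite !inE.
apply: le_trans (expR_ge1Dx _).
rewrite ler_pdivrMr ?exprn_gt0// mulrDl mul1r mulNr.
have := card_fall_ge_lower k Mtheta theta_gt0; rewrite -/x -/F -/p => hF.
have : #|F|%:R + #|(~: F)%SET|%:R = 2 ^+ k :> R.
  by rewrite -natrD cardsC -cardsT -powersetT card_powerset cardsT card_ord
    natrX.
by move: hF; lra.
Qed.

(** For fixed N a single block of independent walks suffices: all of them fail with probability at
    most e^(- m p), which is made smaller than any e. *)
Lemma ae_infinitely_often_le (eps : R) : 0 < eps < theta^-1 ->
  \forall w \ae P, forall N, exists n, (N <= n)%N /\ exists k,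
    Z5 delta k n w <= (1 - theta^-1 + eps) * ln n%:R.
Proof.
move=> /andP[eps0 eps1].
apply: ae_foralln => N.
pose A := [set w | good delta w /\ forall n, (N <= n)%N -> forall k,
    ~ (Z5 delta k n w <= (1 - theta^-1 + eps) * ln n%:R)].
have : \forall w \ae P, ~ A w.
  apply: outer_le_ae => e e0.
  pose g := theta^-1 - eps.
  have g0 : 0 < g by rewrite subr_gt0.
  (* With g' strictly between g and 1 / theta, beta = s0 / g' satisfies both theta s0 < beta (that
     is h > 0) and g beta < s0 (that is r > 0). *)
  pose g' := theta^-1 - eps / 2.
  have gg' : g < g' by rewrite /g /g'; lra.
  have g'0 : 0 < g' by exact: lt_trans gg'.
  pose s0 : R := M5_slope theta.
  have s00 : 0 < s0 by exact: M5_slope_gt0.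
  pose beta := s0 / g'.
  have beta0 : 0 < beta by rewrite divr_gt0.
  pose h := beta - theta * s0.
  have h0 : 0 < h.
    rewrite subr_gt0 /beta mulrC ltr_pM2l// -[ltLHS]invrK.
    rewrite ltf_pV2 ?posrE ?invr_gt0//.
    by rewrite /g' gtrBl divr_gt0.
  pose r := s0 - g * beta.
  have r0 : 0 < r.
    by rewrite subr_gt0 /beta mulrCA gtr_pMr// ltr_pdivrMr// mul1r.
  pose c := expR (- (theta * ln 5)).
  have c0 : 0 < c by exact: expR_gt0.
  have ln50 : 0 <= ln 5 :> R by apply: ln_ge0; lra.
  have ln40 : 0 <= ln 4 :> R by apply: ln_ge0; lra.
  (* Thresholds for k: beyond [X1] the fall exceeds g times the logarithm of the start, beyond [X2]
     the starts exceed N, beyond [X3] one has m p >= 1 / e. *)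
  pose X1 := (ln 5 + g * ln 4) / r.
  pose X2 := N%:R / beta.
  pose X3 := 4 / (c * h ^+ 2 * e).
  have h20 : 0 < h ^+ 2 by rewrite exprn_gt0.
  have X10 : 0 <= X1.
    apply: divr_ge0; last exact: ltW.
    by apply: addr_ge0 => //; apply: mulr_ge0 => //; exact: ltW.
  have X20 : 0 <= X2 by rewrite divr_ge0// ltW.
  have X30 : 0 <= X3 by rewrite divr_ge0 ?ltW ?mulr_gt0.
  pose k' := Num.truncn (X1 + X2 + X3); pose k := k'.+1.
  have kX : X1 + X2 + X3 < k%:R by exact: truncnS_gt.
  have k1 : 1 <= k%:R :> R by rewrite ler1n.
  have kX1 : ln 5 + g * ln 4 <= k%:R * r by rewrite -ler_pdivrMr// -/X1; lra.
  have kX2 : N%:R <= k%:R * beta by rewrite -ler_pdivrMr// -/X2; lra.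
  have kX3 : 4 <= k%:R * (c * h ^+ 2 * e).
    by rewrite -ler_pdivrMr ?mulr_gt0// -/X3; lra.
  (* The walks from the m starting points m, ..., 2m - 1 with m ~ expR (k beta)
     are independent, and each one falls by k s0 - ln 5 in k steps with
     probability at least p, where m p grows like expR (k h) / k. *)
  pose N' := Num.truncn (expR (k%:R * beta)); pose m := N'.+1.
  have m_gt : expR (k%:R * beta) < m%:R by exact: truncnS_gt.
  have m_le : m%:R <= expR (k%:R * beta) + 1.
    by rewrite -natr1 lerD2r; case/andP: (truncn_itv (expR_ge0 (k%:R * beta))).
  have e1 : 1 <= expR (k%:R * beta).
    by apply: le_trans (expR_ge1Dx _); rewrite lerDl mulr_ge0// ltW.
  have Nm : (N <= m)%N.
    rewrite -(ler_nat R) (le_trans kX2)// ltW//.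
    by apply: le_lt_trans m_gt; apply: le_trans (expR_ge1Dx _); lra.
  pose p := k.+1%:R^-1 * expR (- (theta * (k%:R * s0 + ln 5))).
  pose F := [set s : {set 'I_k} | ~~ (k%:R * s0 - ln 5 <= fall s)]%SET.
  apply: outer_le_trans (outer_le_sub _
    (@outer_le_block _ _ _ _ _ hmodel k' N' m F (ltn0Sn _))); last first.
    move=> w [gw hw]; split=> // j; rewrite inE; apply/negP => hf.
    have n0 : (0 < m + j)%N by [].
    apply: (hw (m + j)%N (leq_trans Nm (leq_addr _ _)) k).
    rewrite (Z5_good _ gw)//.
    (* Here j < m and m <= 2 e^(k beta), whence the factor 4. *)
    have lnn : ln (m + j)%:R <= ln 4 + k%:R * beta.
      rewrite -ler_expR lnK ?posrE ?ltr0n// expRD lnK ?posrE//.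
      apply: (@le_trans _ _ (m%:R + m%:R)); last by lra.
      by rewrite natrD lerD2l ler_nat; exact: ltnW (ltn_ord j).
    have := ler_wpM2l (ltW g0) lnn.
    have -> : (1 - theta^-1 + eps) * ln (m + j)%:R =
      ln (m + j)%:R - g * ln (m + j)%:R by rewrite /g; ring.
    move: kX1 hf; rewrite /r; lra.
  have p0 : 0 < p by rewrite mulr_gt0 ?expR_gt0// invr_gt0.
  have mp : e^-1 <= m%:R * p.
    (* Quadratic growth in k is enough to beat the factor 1 / (k + 1) in p. *)
    have hk : h ^+ 2 * k%:R ^+ 2 / 2 <= expR (k%:R * h).
      have kh0 : 0 <= k%:R * h by rewrite mulr_ge0// ltW.
      have := expR_ge1Dxn 1 kh0; rewrite exprMn (_ : 2`! = 2)//; lra.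
    have -> : m%:R * p =
        m%:R * expR (- (k%:R * beta)) * expR (k%:R * h) * c / k.+1%:R.
      have pE : expR (- (theta * (k%:R * s0 + ln 5))) =
          expR (- (k%:R * beta)) * expR (k%:R * h) * c.
        by rewrite -!expRD; congr expR; rewrite /h; ring.
      by rewrite /p pE [_^-1 * _]mulrC !mulrA.
    have m1 : 1 <= m%:R * expR (- (k%:R * beta)).
      by rewrite expRN ler_pdivlMr ?expR_gt0// mul1r ltW.
    rewrite ler_pdivlMr ?ltr0n// -[leLHS]mulrC ler_pdivrMr//.
    apply: (@le_trans _ _ (1 * expR (k%:R * h) * c * e)); last first.
      by rewrite !ler_wpM2r// ?expR_ge0// ltW.
    rewrite mul1r.
    apply: (@le_trans _ _ (h ^+ 2 * k%:R ^+ 2 / 2 * c * e)); last first.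
      by rewrite !ler_wpM2r// ltW.
    have := ler_wpM2l (le_trans ler01 k1) kX3; rewrite -natr1.
    move: k1; lra.
  apply: (@le_trans _ _ (expR (- p) ^+ m)).
    by rewrite lerXn2r// ?nnegrE ?divr_ge0 ?expR_ge0//; exact: card_fall_lt.
  rewrite -expRM_natl mulrN.
  apply: (le_trans (expRN_le_inv _)); first by rewrite mulr_gt0.
  by rewrite -[leRHS]invrK lef_pV2 ?posrE ?invr_gt0// mulr_gt0.
move=> nA; have ag := ae_good hmodel; move: nA ag; apply: filterS2 => w nAw gw.
apply: contrapT => hw; apply: nAw; split => // n Nn k hk; apply: hw.
by exists n; split => //; exists k.
Qed.

End AlmostSure.

(** * An epsilon criterion for the lower limit *)

Section LimInf.
Context {R : realType}.
Implicit Types (u : (\bar R)^nat) (c : R).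

Lemma limn_einf_eq u c :
  (forall e, 0 < e -> exists N, forall n, (N <= n)%N -> ((c - e)%:E <= u n)%E) ->
  (forall e, 0 < e -> forall N, exists n, (N <= n)%N /\ (u n <= (c + e)%:E)%E) ->
  limn_einf u = c%:E.
Proof.
move=> lo up; rewrite limn_einf_lim (cvg_lim _ (cvg_einfs_sup (u := u)))//.
apply/eqP; rewrite eq_le; apply/andP; split.
  apply: ge_ereal_sup => _ [N _ <-]; apply/lee_addgt0Pr => e e0.
  have [n [Nn un]] := up e e0 N.
  rewrite -EFinD; apply: le_trans un.
  by apply: ereal_inf_lbound; exists n.
apply/lee_addgt0Pr => e e0; have [N hN] := lo e e0.
rewrite -leeBlDr// -EFinB.
apply: le_trans (_ : (einfs u N <= _)%E); last first.
  by apply: ereal_sup_ubound; exists N.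
by apply: le_ereal_inf_tmp => _ [n /= Nn <-]; exact: hN.
Qed.

End LimInf.

(** * From walks to the normalized infima *)

Section Quotients.
Context {R : realType} {d : measure_display} {T : measurableType d}.
Variables (P : probability T R) (delta : nat -> nat -> {RV P >-> R}).
Variables (n : nat) (w : T) (a : R).
Hypothesis n_gt1 : (1 < n)%N.

Let lnn_gt0 : 0 < ln n%:R :> R. Proof. by rewrite ln_gt0// ltr1n. Qed.

Lemma t_minus_ge (c : R) : (forall k, c <= Z5 delta k n w) ->
  ((expR c)%:E <= t_minus delta n w)%E.
Proof.
by move=> h; apply: le_ereal_inf_tmp => _ [k _ <-]; rewrite lee_fin ler_expR.
Qed.

(** Places [t_minus] in [0, +oo], where [expeR] inverts [lne]. *)
Lemma t_minus_ge0 : (0 <= t_minus delta n w)%E.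
Proof.
by apply: le_ereal_inf_tmp => _ [k _ <-]; rewrite lee_fin expR_ge0.
Qed.

Lemma lne_t_minus_ge : (forall k, a * ln n%:R <= Z5 delta k n w) ->
  (a%:E <= lne (t_minus delta n w) / (ln n%:R)%:E)%E.
Proof.
move=> /t_minus_ge h.
rewrite inver gt_eqF// lee_pdivlMr//= -EFinM -lee_expeR lneK ?in_itv/= ?leey.
  by [].
by rewrite t_minus_ge0.
Qed.

Lemma lne_t_minus_le : (exists k, Z5 delta k n w <= a * ln n%:R) ->
  (lne (t_minus delta n w) / (ln n%:R)%:E <= a%:E)%E.
Proof.
move=> [k hk].
have h : (t_minus delta n w <= (expR (a * ln n%:R))%:E)%E.
  apply: (@le_trans _ _ (expR (Z5 delta k n w))%:E).
    by apply: ereal_inf_lbound; exists k.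
  by rewrite lee_fin ler_expR.
rewrite inver gt_eqF// lee_pdivrMr//= -EFinM -lee_expeR lneK ?in_itv/= ?leey.
  by [].
by rewrite t_minus_ge0.
Qed.

Lemma inf_Z5_ge : (forall k, a * ln n%:R <= Z5 delta k n w) ->
  (a%:E <= ereal_inf [set (Z5 delta k n w / ln n%:R)%:E | k in [set: nat]])%E.
Proof.
move=> h; apply: le_ereal_inf_tmp => _ [k _ <-].
by rewrite lee_fin ler_pdivlMr.
Qed.

Lemma inf_Z5_le : (exists k, Z5 delta k n w <= a * ln n%:R) ->
  (ereal_inf [set (Z5 delta k n w / ln n%:R)%:E | k in [set: nat]] <= a%:E)%E.
Proof.
move=> [k hk]; apply: (@le_trans _ _ (Z5 delta k n w / ln n%:R)%:E).
  by apply: ereal_inf_lbound; exists k.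
by rewrite lee_fin ler_pdivrMr.
Qed.

End Quotients.

(* The quotients by log n are junk for n = 0, 1, which no liminf sees.  The decimals
   0.3490813 and -1.86466 are split to avoid large unary numerals; 0.3490813 is
   a truncation (theta_star = 0.34908136...), so both approximations are stated
   up to one unit in the last displayed digit. *)
Theorem theorem8p4 (R : realType) (d : measure_display) (T : measurableType d)
    (P : probability T R) (delta : nat -> nat -> {RV P >-> R})
    (hmodel : rrw_model delta) :
  (\forall w \ae P, forall n : nat, (0 < n)%N ->
     (0 < t_minus delta n w < +oo)%E) /\
  exists theta_star : R,
    [/\ 0 < theta_star,
        forall theta : R,
          M5_RRW theta = 1 <-> theta = 0 \/ theta = theta_star,
        `|theta_star - (349 * 10 ^+ 4 + 813) / 10 ^+ 7| < 10 ^- 7,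
        `|(1 - theta_star^-1) - (- (186 * 10 ^+ 3 + 466) / 10 ^+ 5)| < 10 ^- 5 &
        \forall w \ae P,
          limn_einf (fun n : nat =>
            lne (t_minus delta n w) / (ln n%:R)%:E)%E
            = (1 - theta_star^-1)%:E /\
          limn_einf (fun n : nat =>
            ereal_inf [set (Z5 delta k n w / ln n%:R)%:E | k in [set: nat]])
            = (1 - theta_star^-1)%:E].
Proof.
have [theta Mtheta /andP[lo hi]] := @M5_root_exists R.
have theta0 : 0 < theta by apply: lt_trans lo; rewrite /theta_lo; lra.
split.
  have h n : \forall w \ae P, (0 < n)%N ->
      exists c : R, forall k, c <= Z5 delta k n w.
    have [n0|] := boolP (0 < n)%N; last by move=> _; exact: aeW.
    by have := ae_Z5_bounded_below hmodel theta0 Mtheta n0; apply: filterS.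
  have := ae_foralln h; apply: filterS => w hw n n0.
  have [c hc] := hw n n0; apply/andP; split.
    by apply: lt_le_trans (t_minus_ge hc); rewrite lte_fin expR_gt0.
  apply: (@le_lt_trans _ _ (expR (Z5 delta 0 n w))%:E); last exact: ltry.
  by apply: ereal_inf_lbound; exists 0%N.
exists theta; split => //.
- exact: M5_roots.
- move: lo hi; rewrite /theta_lo /theta_hi ltr_norml => lo hi.
  by apply/andP; split; lra.
- have t1 : theta^-1 < (2864 * 10 ^+ 3 + 665) / 10 ^+ 6.
    by rewrite -[ltLHS]mul1r (ltr_pdivrMr _ _ theta0); move: lo; rewrite /theta_lo; lra.
  have t2 : (2864 * 10 ^+ 3 + 655) / 10 ^+ 6 < theta^-1.
    by rewrite -[ltRHS]mul1r (ltr_pdivlMr _ _ theta0); move: hi; rewrite /theta_hi; lra.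
  by move: t1 t2; rewrite ltr_norml => t1 t2; apply/andP; split; lra.
have thV : 0 < theta^-1 by rewrite invr_gt0.
(* Countably many epsilons tending to 0, so that the almost sure events can be intersected; those
   for [H2] must stay below 1 / theta. *)
have H1 m := ae_eventually_ge hmodel theta0 Mtheta (divr_gt0 ltr01 (ltr0Sn R m)).
have e2 m : 0 < theta^-1 / m.+2%:R < theta^-1.
  by rewrite divr_gt0//= gtr_pMr// invf_lt1// ltr1n.
have H2 m := ae_infinitely_often_le hmodel theta0 Mtheta (e2 m).
have := ae_foralln H2; have := ae_foralln H1.
apply: filterS2 => w {}H1 {}H2.
have lower e : 0 < e -> exists N, forall n, (N <= n)%N -> (1 < n)%N /\ forall k,
    (1 - theta^-1 - e) * ln n%:R <= Z5 delta k n w.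
  move=> e0; pose m := Num.truncn e^-1.
  have me : 1 / m.+1%:R <= e.
    by rewrite div1r -[leRHS]invrK lef_pV2 ?posrE ?invr_gt0// ltW// truncnS_gt.
  (* The shift by 2 forces n > 1, so that ln n > 0. *)
  have [N hN] := H1 m; exists (N + 2)%N => n Nn.
  have n1 : (1 < n)%N by apply: leq_trans Nn; rewrite leq_addl.
  split => // k; apply: le_trans (hN n _ k); last first.
    by apply: leq_trans Nn; rewrite leq_addr.
  by rewrite ler_wpM2r ?lerB// ln_ge0// ler1n ltnW.
have upper e : 0 < e -> forall N, exists n, [/\ (N <= n)%N, (1 < n)%N & exists k,
    Z5 delta k n w <= (1 - theta^-1 + e) * ln n%:R].
  move=> e0 N; pose m := Num.truncn (theta^-1 / e).
  have me : theta^-1 / m.+2%:R <= e.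
    rewrite ler_pdivrMr// mulrC -ler_pdivrMr// ltW//.
    by apply: lt_le_trans (truncnS_gt _) _; rewrite ler_nat.
  have [n [Nn [k hk]]] := H2 m (N + 2)%N.
  have n1 : (1 < n)%N by apply: leq_trans Nn; rewrite leq_addl.
  exists n; split => //; first by apply: leq_trans Nn; rewrite leq_addr.
  exists k; apply: (le_trans hk).
  by rewrite ler_wpM2r ?lerD2l// ln_ge0// ler1n ltnW.
split; apply: limn_einf_eq => e e0.
- have [N hN] := lower e e0; exists N => n /hN[n1 hn]; exact: lne_t_minus_ge.
- move=> N; have [n [Nn n1 hn]] := upper e e0 N; exists n; split => //.
  exact: lne_t_minus_le.
- have [N hN] := lower e e0; exists N => n /hN[n1 hn]; exact: inf_Z5_ge.
- move=> N; have [n [Nn n1 hn]] := upper e e0 N; exists n; split => //.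
  exact: inf_Z5_le.
Qed.
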